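(* Let $G$ and $X$ be partial cubes. If both $G$ and $X$ are opposite-semicube-isomorphic, then the Cartesian product $Y=G\,\square\,X$ is also opposite-semicube-isomorphic.
   Context: All graphs are undirected, connected, simple and finite; $d_G$ is the usual shortest-path distance. The Cartesian product $G\,\square\,X$ has vertex set $V(G)\times V(X)$, with $(g,h)$ adjacent to $(g',h')$ iff either $gg'\in E(G)$ and $h=h'$, or $g=g'$ and $hh'\in E(X)$. A partial cube is a graph isomorphic to an isometric subgraph of some hypercube (a subgraph $H$ of $Q$ is isometric if $d_H(x,y)=d_Q(x,y)$ for all $x,y\in V(H)$); the Cartesian product of two partial cubes is a partial cube. The Djokovi\'c–Winkler relation on $E(G)$ is: $uv\,\Theta\,xy$ iff $d_G(u,x)+d_G(v,y)\ne d_G(u,y)+d_G(v,x)$; in a partial cube it is an equivalence relation, and its classes $E_1,\dots,E_d$ are the $\Theta$-classes. For a $\Theta$-class $E_i$ and an edge $xy\in E_i$, the two (opposite) semicubes associated with $E_i$ are $W_i^0=\{a\in V(G): d_G(x,a)<d_G(y,a)\}$ and $W_i^1=\{a\in V(G): d_G(y,a)<d_G(x,a)\}$ (independent of the choice of $xy\in E_i$ up to interchanging the labels $0,1$). A partial cube $G$ is opposite-semicube-isomorphic if $G[W_i^0]\cong G[W_i^1]$ (induced subgraphs) for every $i\in\{1,\dots,d\}$. *)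

(* Defs.v *)
From mathcomp Require Import all_boot.

Set Implicit Arguments.
Unset Strict Implicit.
Unset Printing Implicit Defensive.

(* Finite simple graphs.  Connectedness is the separate predicate [connected],
   so that induced subgraphs are graphs without any proof obligation. *)
Record sgraph := SGraph {
  vertex :> finType;
  edge : rel vertex;
  edge_sym : symmetric edge;
  edge_irr : irreflexive edge
}.

Definition connected (G : sgraph) : Prop :=
  forall x y : G, connect (@edge G) x y.

(* The least k such that there is a walk with k edges from x to y.  A shortest
   walk has fewer than #|G| edges; if there is no walk at all the value is #|G|,
   which is meaningless, so [dist] should only be used on connected graphs. *)
Definition dist (G : sgraph) (x y : G) : nat :=
  find (fun k => [exists p : k.-tuple G, path (@edge G) x p && (last x p == y)])
       (iota 0 #|G|).

Definition graph_iso (G H : sgraph) : Prop :=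
  exists2 f : G -> H, bijective f & forall x y, edge (f x) (f y) = edge x y.

Section Induced.
Variables (G : sgraph) (W : {set G}).
Definition induced_edge : rel {x : G | x \in W} :=
  fun u v => edge (val u) (val v).
Lemma induced_edge_sym : symmetric induced_edge.
Proof. by move=> u v; apply: edge_sym. Qed.
Lemma induced_edge_irr : irreflexive induced_edge.
Proof. by move=> u; apply: edge_irr. Qed.
Definition induced : sgraph := SGraph induced_edge_sym induced_edge_irr.
End Induced.

(* Subgraphs, not necessarily induced. *)
Record subgraph (Q : sgraph) := Subgraph {
  sub_vertices : {set Q};
  sub_edge : rel Q;
  sub_edge_sym : symmetric sub_edge;
  sub_edgeP : forall x y, sub_edge x y ->
    [&& edge x y, x \in sub_vertices & y \in sub_vertices]
}.

Section SubgraphGraph.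
Variables (Q : sgraph) (H : subgraph Q).
Definition subgraph_edge : rel {x : Q | x \in sub_vertices H} :=
  fun u v => sub_edge H (val u) (val v).
Lemma subgraph_edge_sym : symmetric subgraph_edge.
Proof. by move=> u v; apply: sub_edge_sym. Qed.
Lemma subgraph_edge_irr : irreflexive subgraph_edge.
Proof.
by move=> u; apply/negP => /sub_edgeP /andP[]; rewrite edge_irr.
Qed.
Definition subgraph_graph : sgraph :=
  SGraph subgraph_edge_sym subgraph_edge_irr.
End SubgraphGraph.

Definition isometric (Q : sgraph) (H : subgraph Q) : Prop :=
  connected (subgraph_graph H) /\
  forall x y : subgraph_graph H, dist x y = dist (val x) (val y).

Section Hypercube.
Variable n : nat.
Definition hypercube_edge : rel {ffun 'I_n -> bool} :=
  fun x y => #|[set i | x i != y i]| == 1.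
Lemma hypercube_edge_sym : symmetric hypercube_edge.
Proof.
move=> x y; rewrite /hypercube_edge; congr (_ == 1).
by apply: eq_card => i; rewrite !inE eq_sym.
Qed.
Lemma hypercube_edge_irr : irreflexive hypercube_edge.
Proof.
move=> x; rewrite /hypercube_edge (_ : [set i | _] = set0) ?cards0 //.
by apply/setP => i; rewrite !inE eqxx.
Qed.
Definition hypercube : sgraph := SGraph hypercube_edge_sym hypercube_edge_irr.
End Hypercube.

Definition partial_cube (G : sgraph) : Prop :=
  exists (n : nat) (H : subgraph (hypercube n)),
    isometric H /\ graph_iso G (subgraph_graph H).

Section CartesianProduct.
Variables G X : sgraph.
Definition cart_edge : rel (G * X) := fun u v =>
  (edge u.1 v.1 && (u.2 == v.2)) || ((u.1 == v.1) && edge u.2 v.2).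
Lemma cart_edge_sym : symmetric cart_edge.
Proof.
move=> u v; rewrite /cart_edge ![edge u.1 _]edge_sym ![edge u.2 _]edge_sym.
by rewrite (eq_sym u.1) (eq_sym u.2).
Qed.
Lemma cart_edge_irr : irreflexive cart_edge.
Proof. by move=> u; rewrite /cart_edge !edge_irr andbF. Qed.
Definition cartesian_product : sgraph := SGraph cart_edge_sym cart_edge_irr.
End CartesianProduct.

(* Edges are unordered pairs.  Swapping u and v, or x and y, exchanges the two
   sides of the disequation in [Theta], which therefore does not depend on how
   the endpoints of e and f are named. *)
Definition edges (G : sgraph) : {set {set G}} :=
  [set [set p.1; p.2] | p : G * G & edge p.1 p.2].

Definition Theta (G : sgraph) (e f : {set G}) : bool :=
  [exists u, exists v, exists x, exists y,
    [&& e == [set u; v], f == [set x; y] &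
        dist u x + dist v y != dist u y + dist v x]].

Definition Theta_classes (G : sgraph) : {set {set {set G}}} :=
  equivalence_partition (@Theta G) (edges G).

Definition semicube (G : sgraph) (x y : G) : {set G} :=
  [set a | dist x a < dist y a].

(* The two semicubes of a class E are [semicube x y] and [semicube y x] for any
   edge xy in E; in a partial cube this unordered pair of sets depends on E
   only, hence the quantification over all representatives. *)
Definition opposite_semicube_isomorphic (G : sgraph) : Prop :=
  partial_cube G /\
  forall E, E \in Theta_classes G ->
  forall x y : G, [set x; y] \in E ->
    graph_iso (induced (semicube x y)) (induced (semicube y x)).

(* Main.v *)
Require Import Defs.
From mathcomp Require Import all_boot.

(** Distances in a Cartesian product add up coordinatewise.  Hence juxtaposing
    isometric embeddings of G and X into hypercubes embeds the product
    isometrically.  An edge of the product moves a single coordinate, say along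
    the edge uv of G, and by additivity its two semicubes are the products of
    the semicubes of uv with the whole of X; the isomorphism between the latter,
    times the identity of X, is the required one. *)

Set Implicit Arguments.
Unset Strict Implicit.
Unset Printing Implicit Defensive.

(** * Walks and distances *)

Section Distance.
Variable G : sgraph.
Implicit Types (x y z : G) (p q : seq G).

Lemma dist_le x p : path (@edge G) x p -> dist x (last x p) <= size p.
Proof.
move=> path_p; have [le_p | lt_p] := leqP #|G| (size p).
  (* For a walk this long the bound is automatic: [find] never exceeds the length [#|G|] of the
     list, its default value included. *)
  by apply: leq_trans le_p; apply: leq_trans (find_size _ _) _; rewrite size_iota.
rewrite leqNgt; apply/negP => /[dup] lt_d /(before_find 0).
rewrite nth_iota // add0n => /existsP[].
by exists (in_tuple p); rewrite path_p eqxx.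
Qed.

(** Shortening a walk to one without repeated vertices leaves fewer than [#|G|] edges, so the search
    in [dist] succeeds and its result is realised by a walk. *)
Lemma dist_walk x y : connect (@edge G) x y ->
  exists p, [/\ path (@edge G) x p, last x p = y & size p = dist x y].
Proof.
case/connectP => q path_q ->; case/shortenP: path_q => p path_p uniq_p _.
have lt_p : size p < #|G|.
  by have := max_card (mem (x :: p)); rewrite (card_uniqP uniq_p).
set P := fun k => [exists q : k.-tuple G,
  path (@edge G) x q && (last x q == last x p)].
have hasP : has P (iota 0 #|G|).
  apply/hasP; exists (size p); first by rewrite mem_iota.
  by apply/existsP; exists (in_tuple p); rewrite path_p eqxx.
have lt_d : dist x (last x p) < #|G| by move: hasP; rewrite has_find size_iota.
have := nth_find 0 hasP; rewrite nth_iota // add0n.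
by case/existsP => r /andP[path_r /eqP last_r]; exists r; rewrite size_tuple.
Qed.

Lemma dist_unique x y p :
    path (@edge G) x p -> last x p = y ->
    (forall q, path (@edge G) x q -> last x q = y -> size p <= size q) ->
  dist x y = size p.
Proof.
move=> path_p last_p min_p; apply/eqP; rewrite eqn_leq.
rewrite -{1}last_p dist_le //=.
have [|q [path_q last_q <-]] := @dist_walk x y; last exact: min_p.
by apply/connectP; exists p.
Qed.

Lemma distxx x : dist x x = 0.
Proof. exact: (@dist_unique x x [::]). Qed.

Hypothesis conG : connected G.

Lemma dist_eq0 x y : (dist x y == 0) = (x == y).
Proof.
apply/eqP/eqP => [|->]; last exact: distxx.
by have [p [_ <- <-]] := dist_walk (conG x y) => /size0nil ->.
Qed.

Lemma dist_eq1 x y : (dist x y == 1) = edge x y.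
Proof.
apply/eqP/idP => [|xy].
  have [p [path_p <- <-]] := dist_walk (conG x y).
  by case: p path_p => [|z []] //=; rewrite andbT.
apply: (@dist_unique x y [:: y]) => //=; first by rewrite xy.
by case=> //= _ eq_xy; rewrite eq_xy edge_irr in xy.
Qed.

Lemma dist_edge x y z : edge x y -> dist x z <= (dist y z).+1.
Proof.
move=> xy; have [p [path_p <- <-]] := dist_walk (conG y z).
by apply: (@dist_le x (y :: p)); rewrite /= xy.
Qed.

End Distance.

(** * Distances under homomorphisms and isomorphisms *)

Section Homomorphism.
Variables (G H : sgraph) (f : G -> H).
Hypothesis hom_f : forall a b, edge a b -> edge (f a) (f b).

Lemma hom_path x p : path (@edge G) x p -> path (@edge H) (f x) (map f p).
Proof. by rewrite path_map; apply: sub_path => a b; apply: hom_f. Qed.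

Lemma hom_connect x y : connect (@edge G) x y -> connect (@edge H) (f x) (f y).
Proof.
case/connectP => p path_p ->; apply/connectP.
by exists (map f p); rewrite ?last_map ?hom_path.
Qed.

Lemma hom_dist x y : connected G -> dist (f x) (f y) <= dist x y.
Proof.
move=> conG; have [p [path_p <- <-]] := dist_walk (conG x y).
by rewrite -last_map -(size_map f) dist_le ?hom_path.
Qed.

End Homomorphism.

Section Isomorphism.
Variables (G H : sgraph) (f : G -> H).
Hypothesis bij_f : bijective f.
Hypothesis edge_f : forall x y, edge (f x) (f y) = edge x y.

Lemma iso_connected : connected G -> connected H.
Proof.
case: bij_f => g _ gK conG x y; rewrite -(gK x) -(gK y).
by apply: hom_connect => // a b; rewrite edge_f.
Qed.

(** Both the map and its inverse are homomorphisms, so neither increases distances. *)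
Lemma iso_dist x y : connected G -> dist (f x) (f y) = dist x y.
Proof.
move=> conG; case: bij_f => g fK gK; apply/eqP; rewrite eqn_leq.
rewrite hom_dist => [|a b|//]; last by rewrite edge_f.
rewrite -{1}(fK x) -{1}(fK y) hom_dist // => [a b|]; first by rewrite -edge_f !gK.
exact: iso_connected.
Qed.

End Isomorphism.

Lemma graph_iso_sym (G H : sgraph) : graph_iso G H -> graph_iso H G.
Proof.
case=> f [g fK gK] edge_f; exists g; first by exists f.
by move=> x y; rewrite -edge_f !gK.
Qed.

(** * The hypercube metric as Hamming distance *)

Section Hamming.
Variable n : nat.
Implicit Types x y z : {ffun 'I_n -> bool}.

Definition hamming x y : nat := \sum_i (x i != y i).

Lemma hammingE x y : hamming x y = #|[set i | x i != y i]|.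
Proof. by rewrite cardsE -sum1_card big_mkcond. Qed.

Lemma hypercube_edgeE x y : hypercube_edge x y = (hamming x y == 1).
Proof. by rewrite hammingE. Qed.

Lemma hamming_eq0 x y : (hamming x y == 0) = (x == y).
Proof.
rewrite /hamming sum_nat_eq0; apply/forallP/eqP => [eq_xy | -> i]; last by rewrite eqxx.
by apply/ffunP => i; have := eq_xy i; case: (x i =P y i).
Qed.

Lemma hamming_triangle x y z : hamming x z <= hamming x y + hamming y z.
Proof.
rewrite /hamming -big_split leq_sum //= => i _.
by case: (x i) (y i) (z i) => [] [] [].
Qed.

(** The vertex [z] is [x] with one wrong coordinate corrected to agree with [y]; iterating this
    produces a geodesic. *)
Lemma hamming_step x y : 0 < hamming x y ->
  exists z, hamming x z = 1 /\ (hamming z y).+1 = hamming x y.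
Proof.
rewrite lt0n hamming_eq0 => neq_xy.
have [i neq_i] : exists i, x i != y i.
  apply/existsP; apply: contraR neq_xy; rewrite negb_exists => /forallP eq_xy.
  by apply/eqP/ffunP => i; have := eq_xy i; rewrite negbK => /eqP.
exists [ffun j => if j == i then y j else x j]; split.
  rewrite /hamming (bigD1 i) //= big1 => [|j /negPf ji].
    by rewrite ffunE eqxx neq_i.
  by rewrite ffunE ji eqxx.
rewrite /hamming (bigD1 i) //= [in RHS](bigD1 i) //= ffunE !eqxx neq_i.
by congr _.+1; apply: eq_bigr => j /negPf ji; rewrite ffunE ji.
Qed.

Lemma hamming_path (x : hypercube n) p :
  path (@edge (hypercube n)) x p -> hamming x (last x p) <= size p.
Proof.
elim: p x => [|y p IHp] x /=; first by rewrite leqn0 hamming_eq0.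
rewrite hypercube_edgeE => /andP[/eqP xy /IHp le_p].
by apply: leq_trans (hamming_triangle x y _) _; rewrite xy.
Qed.

(** Correcting coordinates one at a time gives a walk of length [hamming x y], and [hamming_path]
    shows that no walk is shorter. *)
Lemma hypercube_dist (x y : hypercube n) : dist x y = hamming x y.
Proof.
have [p [path_p last_p size_p]] : exists p : seq (hypercube n),
    [/\ path (@edge (hypercube n)) x p, last x p = y & size p = hamming x y].
  have [d] := ubnP (hamming x y); elim: d x => // d IHd x le_d.
  have [/eqP | /hamming_step[z [xz zy]]] := posnP (hamming x y).
    by rewrite hamming_eq0 => /eqP <-; exists [::]; split=> //; apply/esym/eqP;
       rewrite hamming_eq0.
  have [|p [path_p last_p size_p]] := IHd z; first by rewrite zy.
  by exists (z :: p); split=> //=; rewrite ?hypercube_edgeE ?xz ?size_p.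
rewrite -size_p; apply: dist_unique path_p last_p _ => q path_q last_q.
by rewrite size_p -last_q hamming_path.
Qed.

End Hamming.

(** * Partial cubes as graphs labelled isometrically by bit strings *)

Section IsometricImage.
Variables (G : sgraph) (n : nat) (f : G -> hypercube n).
Hypothesis conG : connected G.
Hypothesis isom_f : forall x y, dist x y = hamming (f x) (f y).

Lemma isometric_inj : injective f.
Proof.
by move=> x y /eqP; rewrite -hamming_eq0 -isom_f dist_eq0 // => /eqP.
Qed.

(** The image is taken as an induced subgraph of the cube. This creates no edges beyond those of
    [G], since labels at Hamming distance 1 come from vertices at distance 1. *)
Definition image_edge : rel (hypercube n) := fun a b =>
  [&& edge a b, a \in f @: G & b \in f @: G].

Lemma image_edge_sym : symmetric image_edge.
Proof. by move=> a b; rewrite /image_edge edge_sym [X in _ && X]andbC. Qed.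

Lemma image_edgeP a b :
  image_edge a b -> [&& edge a b, a \in f @: G & b \in f @: G].
Proof. by []. Qed.

Definition image_subgraph : subgraph (hypercube n) :=
  Subgraph image_edge_sym image_edgeP.

Definition to_image (x : G) : subgraph_graph image_subgraph :=
  exist _ (f x) (imset_f f (isT : x \in G)).

Lemma to_image_bij : bijective to_image.
Proof.
have inv (u : subgraph_graph image_subgraph) : exists x, f x == val u.
  by have /imsetP[x _ ->] := valP u; exists x.
exists (fun u => xchoose (inv u)) => [x | u].
  by apply: isometric_inj; rewrite (eqP (xchooseP (inv _))).
by apply: val_inj; rewrite /= (eqP (xchooseP (inv u))).
Qed.

Lemma to_image_edge x y : edge (to_image x) (to_image y) = edge x y.
Proof.
rewrite /= /subgraph_edge /= /image_edge !imset_f // !andbT /=.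
by rewrite hypercube_edgeE -isom_f dist_eq1.
Qed.

Lemma image_isometric : isometric image_subgraph.
Proof.
have con_im := iso_connected to_image_bij to_image_edge conG.
split=> // u v; have [g _ gK] := to_image_bij; rewrite -(gK u) -(gK v).
by rewrite (iso_dist to_image_bij to_image_edge) // hypercube_dist isom_f.
Qed.

End IsometricImage.

(** Trades the subgraph and the isomorphism for a single distance-preserving labelling, a form in
    which products amount to concatenation. *)
Lemma partial_cubeP (G : sgraph) :
  partial_cube G <->
  connected G /\ exists n (f : G -> {ffun 'I_n -> bool}),
    forall x y, dist x y = hamming (f x) (f y).
Proof.
split=> [[n [H [[conH isoH] iso_GH]]] | [conG [n [f isom_f]]]].
  have conG : connected G.
    by have [g bij_g edge_g] := graph_iso_sym iso_GH; exact: iso_connected edge_g conH.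
  case: iso_GH => f bij_f edge_f; split=> //; exists n, (fun x => val (f x)).
  by move=> x y; rewrite -hypercube_dist -isoH (iso_dist bij_f).
exists n, (image_subgraph f); split; first exact: image_isometric.
exists (to_image f); first exact: to_image_bij.
by move=> x y; apply: to_image_edge.
Qed.

(** * Distances and semicubes in the Cartesian product *)

Section Product.
Variables G X : sgraph.
Hypotheses (conG : connected G) (conX : connected X).
Local Notation GX := (cartesian_product G X).

Lemma product_edge_left (b : X) (u v : G) :
  edge u v -> edge ((u, b) : GX) ((v, b) : GX).
Proof. by move=> uv; rewrite /= /cart_edge /= uv eqxx. Qed.

Lemma product_edge_right (a : G) (h k : X) :
  edge h k -> edge ((a, h) : GX) ((a, k) : GX).
Proof. by move=> hk; rewrite /= /cart_edge /= hk eqxx orbT. Qed.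

Lemma product_connected : connected GX.
Proof.
case=> [a b] [c d]; apply: (@connect_trans _ _ ((c, b) : GX)).
  exact: (hom_connect (product_edge_left b)).
exact: (hom_connect (product_edge_right c)).
Qed.

(** Each step moves one coordinate along an edge and fixes the other, so it lowers the sum of the
    two distances to the endpoint by at most one. *)
Lemma product_path (w : GX) p :
    path (@edge GX) w p ->
  dist w.1 (last w p).1 + dist w.2 (last w p).2 <= size p.
Proof.
elim: p w => [|w' p IHp] w /=; first by rewrite !distxx.
case/andP => ww' /IHp; rewrite -ltnS; apply: leq_trans.
case/orP: ww' => /andP[].
  by move=> /(dist_edge conG) le_w /eqP ->; rewrite -addSn leq_add2r.
by move=> /eqP -> /(dist_edge conX) le_w; rewrite -addnS leq_add2l.
Qed.

Lemma product_dist (w w' : GX) : dist w w' = dist w.1 w'.1 + dist w.2 w'.2.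
Proof.
case: w w' => [a b] [c d] /=.
have [p [path_p last_p size_p]] := dist_walk (conG a c).
have [q [path_q last_q size_q]] := dist_walk (conX b d).
(* A geodesic of the product: first move in [G] with [b] fixed, then in [X] with [c] fixed. *)
pose r : seq GX := map (fun u => (u, b)) p ++ map (fun h => (c, h)) q.
have last_l : last ((a, b) : GX) [seq (u, b) | u <- p] = (c, b).
  by rewrite (last_map (fun u => (u, b))) last_p.
have last_r : last ((a, b) : GX) r = (c, d).
  by rewrite last_cat last_l (last_map (fun h => (c, h))) last_q.
rewrite -size_p -size_q -(size_map (fun u => (u, b)) p).
rewrite -(size_map (fun h => (c, h)) q) -size_cat.
apply: dist_unique last_r _ => [|s path_s last_s].
  rewrite cat_path last_l (hom_path (product_edge_left b) path_p).
  exact: (hom_path (product_edge_right c) path_q).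
have := product_path path_s; rewrite last_s /=.
by rewrite size_cat !size_map size_p size_q.
Qed.

(** The two distances being compared share the summand coming from [X], which cancels. *)
Lemma product_semicube_left (u v : G) (h : X) :
  semicube ((u, h) : GX) ((v, h) : GX) = setX (semicube u v) setT.
Proof. by apply/setP => w; rewrite !inE !product_dist ltn_add2r andbT. Qed.

Lemma product_semicube_right (u : G) (h k : X) :
  semicube ((u, h) : GX) ((u, k) : GX) = setX setT (semicube h k).
Proof. by apply/setP => w; rewrite !inE !product_dist ltn_add2l. Qed.

End Product.

Lemma partial_cube_product (G X : sgraph) :
  partial_cube G -> partial_cube X -> partial_cube (cartesian_product G X).
Proof.
move=> /partial_cubeP[conG [m [f isom_f]]] /partial_cubeP[conX [n [g isom_g]]].
apply/partial_cubeP; split; first exact: product_connected.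
(* The label of a pair is the concatenation of the two labels; the Hamming sum then splits into its
   first [m] and last [n] terms. *)
exists (m + n), (fun w => [ffun i : 'I_(m + n) =>
  match split i with inl j => f w.1 j | inr k => g w.2 k end]) => w w'.
rewrite product_dist // isom_f isom_g /hamming big_split_ord /=.
congr (_ + _); apply: eq_bigr => i _; rewrite !ffunE.
  by rewrite (unsplitK (inl i)).
by rewrite (unsplitK (inr i)).
Qed.

Lemma induced_iso_refl (G : sgraph) (A : {set G}) :
  graph_iso (induced A) (induced A).
Proof. by exists id => //; exists id. Qed.

(** * Subgraphs induced on product sets *)

Section InducedProduct.
Variables G X : sgraph.
Local Notation GX := (cartesian_product G X).
Implicit Types (A B : {set G}) (C D : {set X}).

(** With [fstX] and [sndX], this identifies the subgraph induced on [setX A C] with the product of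
    the subgraphs induced on [A] and [C]. *)
Definition pairX A C (u : induced A) (v : induced C) :
    @induced GX (setX A C) :=
  exist _ (val u, val v) (introT setXP (conj (valP u) (valP v))).

Lemma setX_fst A C (w : @induced GX (setX A C)) : (val w).1 \in A.
Proof. by case: w => -[a c] /= /setXP[]. Qed.

Lemma setX_snd A C (w : @induced GX (setX A C)) : (val w).2 \in C.
Proof. by case: w => -[a c] /= /setXP[]. Qed.

Definition fstX A C (w : @induced GX (setX A C)) : induced A :=
  exist _ (val w).1 (setX_fst w).

Definition sndX A C (w : @induced GX (setX A C)) : induced C :=
  exist _ (val w).2 (setX_snd w).

Lemma pairXK1 A C (u : induced A) (v : induced C) : fstX (pairX u v) = u.
Proof. exact: val_inj. Qed.

Lemma pairXK2 A C (u : induced A) (v : induced C) : sndX (pairX u v) = v.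
Proof. exact: val_inj. Qed.

Lemma fst_sndX A C (w : @induced GX (setX A C)) : pairX (fstX w) (sndX w) = w.
Proof. by apply: val_inj; case: w => -[a c]. Qed.

Lemma induced_iso_product A B C D :
    graph_iso (induced A) (induced B) -> graph_iso (induced C) (induced D) ->
  graph_iso (@induced GX (setX A C)) (@induced GX (setX B D)).
Proof.
case=> f bij_f edge_f [g bij_g edge_g].
(* Holds by computation, because equality in a subtype is equality of the underlying values. *)
have edgeX P Q (w w' : @induced GX (setX P Q)) :
    edge w w' = (edge (fstX w) (fstX w') && (sndX w == sndX w'))
             || ((fstX w == fstX w') && edge (sndX w) (sndX w')) by [].
exists (fun w => pairX (f (fstX w)) (g (sndX w))).
  have [[f' fK f'K] [g' gK g'K]] := (bij_f, bij_g).
  exists (fun w => pairX (f' (fstX w)) (g' (sndX w))) => w.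
    by rewrite pairXK1 pairXK2 fK gK fst_sndX.
  by rewrite pairXK1 pairXK2 f'K g'K fst_sndX.
move=> w w'; rewrite !edgeX !pairXK1 !pairXK2 edge_f edge_g.
by rewrite (bij_eq bij_f) (bij_eq bij_g).
Qed.

End InducedProduct.

(** * Edges as unordered pairs, and their Theta-classes *)

Lemma pair_edges (G : sgraph) (x y : G) : ([set x; y] \in edges G) = edge x y.
Proof.
apply/imsetP/idP => [[[a b]] | xy]; last by exists (x, y); rewrite ?inE.
rewrite inE /= => ab eq_xy.
have xab : x \in [set a; b] by rewrite -eq_xy set21.
have yab : y \in [set a; b] by rewrite -eq_xy set22.
have axy : a \in [set x; y] by rewrite eq_xy set21.
have bxy : b \in [set x; y] by rewrite eq_xy set22.
(* This excludes [x = y]: the pair would then be a singleton, forcing [a = b]. *)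
have neq_ab : a != b by apply: contraTneq ab => ->; rewrite edge_irr.
move: xab yab axy bxy neq_ab; rewrite !inE.
case/pred2P=> -> /pred2P[] -> // axy bxy.
- by move: bxy; rewrite orbb eq_sym => ->.
- by rewrite edge_sym.
by move: axy; rewrite orbb => ->.
Qed.

(** For an edge compared with itself the disequation reads 0 + 0 against 1 + 1. *)
Lemma Theta_refl (G : sgraph) (x y : G) :
  connected G -> edge x y -> Theta [set x; y] [set x; y].
Proof.
move=> conG xy; do 2![apply/existsP; exists x; apply/existsP; exists y].
have [dxy dyx] : dist x y = 1 /\ dist y x = 1.
  by split; apply/eqP; rewrite dist_eq1 // edge_sym.
by rewrite !eqxx !distxx dxy dyx.
Qed.

(* Every edge lies in some Theta-class because Theta is reflexive on edges;
   this does not require that Theta is transitive. *)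
Lemma opposite_semicube_isoP (G : sgraph) : partial_cube G ->
  opposite_semicube_isomorphic G <->
  forall x y : G, edge x y ->
    graph_iso (induced (semicube x y)) (induced (semicube y x)).
Proof.
move=> pcG; have [conG _] := (partial_cubeP G).1 pcG.
split=> [[_ isoG] x y xy | isoG].
  apply: (isoG [set f in edges G | Theta [set x; y] f]).
    by apply: imset_f; rewrite pair_edges.
  by rewrite inE pair_edges xy Theta_refl.
split=> // E /imsetP[e _ ->] x y; rewrite inE pair_edges => /andP[xy _].
exact: isoG.
Qed.

Theorem lemma4p1 (G X : sgraph) (hG : partial_cube G) (hX : partial_cube X)
    (oG : opposite_semicube_isomorphic G)
    (oX : opposite_semicube_isomorphic X) :
  opposite_semicube_isomorphic (cartesian_product G X).
Proof.
have [[conG _] [conX _]] := ((partial_cubeP G).1 hG, (partial_cubeP X).1 hX).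
apply/opposite_semicube_isoP; first exact: partial_cube_product.
case=> [u h] [v k] /orP[] /= /andP[].
  move=> uv /eqP <-; rewrite !product_semicube_left //.
  (* The unmoved factor contributes [setT] to both semicubes, so the identity serves there. *)
  apply: induced_iso_product; last exact: induced_iso_refl.
  exact: (opposite_semicube_isoP hG).1.
move=> /eqP <- hk; rewrite !product_semicube_right //.
apply: induced_iso_product; first exact: induced_iso_refl.
exact: (opposite_semicube_isoP hX).1.
Qed.
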